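(* Let $p\ge 1$ be an integer. Suppose that $h\in k\langle\!\langle S\rangle\!\rangle$ has the form $h=e^Z$ with $Z\in k\langle\!\langle S\rangle\!\rangle$ and $Z_0=0$, and write $h=\sum_{j=0}^{\infty} h_j$ with $h_j$ homogeneous of degree $j$. Let $C\in k\langle\!\langle S\rangle\!\rangle$ be homogeneous of degree $1$. Then the following statements are equivalent: (A) $h_0-1=h_1-C=\cdots=h_p-\frac{C^p}{p!}=0$; (B) $\phi(h)^{\cdot}-C\phi(h)=O(t^p)$; (C) $Z-C=O(t^{p+1})$, that is, all homogeneous components of $Z-C$ of degrees $0,1,\ldots,p$ vanish (equivalently $\phi(Z-C)=O(t^{p+1})$).
   Context: $k$ is a field of characteristic zero, $S$ is a set of non-commuting variables, and $k\langle\!\langle S\rangle\!\rangle$ is the algebra of formal power series in the non-commuting variables $S$ with coefficients in $k$, graded by word length: elements of $k$ have degree $0$, words $s_1\cdots s_n$ ($s_i\in S$) have degree $n$, and a homogeneous element of degree $n$ is a $k$-linear combination of elements of degree $n$. Every $f\in k\langle\!\langle S\rangle\!\rangle$ decomposes uniquely as $f=\sum_{j\ge0}f_j$ with $f_j$ homogeneous of degree $j$; in particular $Z_0$ is the constant term of $Z$. For $g$ without constant term, $e^g:=\sum_{j\ge0}\frac1{j!}g^j$. The algebra $k\langle\!\langle S\rangle\!\rangle\langle\!\langle t\rangle\!\rangle$ is the ring of formal power series $\sum_{j\ge0} r_jt^j$ in one variable $t$ (commuting with the coefficients) with coefficients $r_j\in k\langle\!\langle S\rangle\!\rangle$. The map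 $\phi:k\langle\!\langle S\rangle\!\rangle\to k\langle\!\langle S\rangle\!\rangle\langle\!\langle t\rangle\!\rangle$ sends $f=\sum_j f_j$ to $\phi(f)=\sum_j f_jt^j$. Formal differentiation is $\bigl(\sum_{j\ge0} r_jt^j\bigr)^{\cdot}:=\sum_{j\ge1} j\,r_j t^{j-1}$. For $q\ge 0$, $f=\sum_{j\ge 0} r_jt^j=O(t^{q})$ means $r_j=0$ for all $0\le j<q$. *)

(* Defs.v *)
From HB Require Import structures.
From mathcomp Require Import all_boot all_order all_algebra.
From mathcomp Require Import boolp.

Set Implicit Arguments.
Unset Strict Implicit.
Unset Printing Implicit Defensive.

Import GRing.Theory.
Local Open Scope ring_scope.

(* k<<S>>: a series is its family of coefficients, indexed by words.  S may be
   infinite, and a series may have infinitely many terms of a given degree. *)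
Definition ncseries (k : fieldType) (S : Type) : Type := seq S -> k.

HB.instance Definition _ (k : fieldType) (S : Type) := gen_eqMixin (ncseries k S).
HB.instance Definition _ (k : fieldType) (S : Type) :=
  gen_choiceMixin (ncseries k S).

Section NCSeries.
Variables (k : fieldType) (S : Type).
Implicit Types (f g h : ncseries k S) (w : seq S) (a b : k).

Definition nczero : ncseries k S := fun=> 0.
Definition ncopp f : ncseries k S := fun w => - f w.
Definition ncadd f g : ncseries k S := fun w => f w + g w.
Definition ncscale a f : ncseries k S := fun w => a * f w.
Definition ncone : ncseries k S := fun w => (nilp w)%:R.

(* The coefficient of w sums over all the factorizations w = w1 ++ w2. *)
Definition ncmul f g : ncseries k S :=
  fun w => \sum_(i < (size w).+1) f (take i w) * g (drop i w).

Lemma ncaddA : associative ncadd.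
Proof. by move=> f g h; apply/funext=> w; exact: addrA. Qed.

Lemma ncaddC : commutative ncadd.
Proof. by move=> f g; apply/funext=> w; exact: addrC. Qed.

Lemma ncadd0 : left_id nczero ncadd.
Proof. by move=> f; apply/funext=> w; exact: add0r. Qed.

Lemma ncaddN : left_inverse nczero ncopp ncadd.
Proof. by move=> f; apply/funext=> w; exact: addNr. Qed.

HB.instance Definition _ :=
  GRing.isZmodule.Build (ncseries k S) ncaddA ncaddC ncadd0 ncaddN.

Lemma ncmul_nil f g : ncmul f g [::] = f [::] * g [::].
Proof. by rewrite /ncmul big_ord_recl big_ord0 addr0. Qed.

Lemma ncmul_cons f g x w :
  ncmul f g (x :: w) =
  f [::] * g (x :: w) + ncmul (fun u => f (x :: u)) g w.
Proof. by rewrite /ncmul /= big_ord_recl. Qed.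

Lemma ncmulDl : left_distributive ncmul +%R.
Proof.
move=> f g h; apply/funext=> w; rewrite [RHS]/GRing.add /= /ncadd /ncmul.
by rewrite -big_split; apply: eq_bigr => i _; exact: mulrDl.
Qed.

Lemma ncmulDr : right_distributive ncmul +%R.
Proof.
move=> f g h; apply/funext=> w; rewrite [RHS]/GRing.add /= /ncadd /ncmul.
by rewrite -big_split; apply: eq_bigr => i _; exact: mulrDr.
Qed.

Lemma ncscaleAl a f g : ncscale a (ncmul f g) = ncmul (ncscale a f) g.
Proof.
apply/funext=> w; rewrite /ncscale /ncmul mulr_sumr.
by apply: eq_bigr => i _; rewrite mulrA.
Qed.

Lemma ncscaleAr a f g : ncscale a (ncmul f g) = ncmul f (ncscale a g).
Proof.
apply/funext=> w; rewrite /ncscale /ncmul mulr_sumr.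
by apply: eq_bigr => i _; rewrite mulrCA.
Qed.

Lemma ncmulA : associative ncmul.
Proof.
move=> f g h; apply/funext=> w; elim: w f => [|x w IHw] f.
  by rewrite !ncmul_nil mulrA.
have -> : ncmul (ncmul f g) h (x :: w) =
    f [::] * g [::] * h (x :: w) +
    ncmul (ncadd (ncscale (f [::]) (fun u => g (x :: u)))
                 (ncmul (fun u => f (x :: u)) g)) h w.
  rewrite ncmul_cons ncmul_nil; congr (_ + ncmul _ _ _).
  by apply/funext=> u; rewrite ncmul_cons.
rewrite [X in _ + X](congr1 (@^~ w) (ncmulDl _ _ _)) [X in _ + X]/GRing.add /=.
rewrite /ncadd -ncscaleAl -IHw ncmul_cons ncmul_cons /ncscale mulrDr.
by rewrite !mulrA addrA.
Qed.

Lemma ncmul1l : left_id ncone ncmul.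
Proof.
move=> f; apply/funext=> w; rewrite /ncmul big_ord_recl take0 drop0 mul1r.
rewrite big1 ?addr0 // => i _; case: w i => [|x w] i; first by case: i.
by rewrite mul0r.
Qed.

Lemma ncmul1r : right_id ncone ncmul.
Proof.
move=> f; apply/funext=> w; rewrite /ncmul big_ord_recr /= take_size drop_size.
rewrite mulr1 big1 ?add0r // => i _.
by rewrite /ncone /nilp size_drop subn_eq0 leqNgt ltn_ord mulr0.
Qed.

Lemma ncone_neq0 : ncone != 0 :> ncseries k S.
Proof.
by apply/eqP => /(congr1 (@^~ [::])) /eqP; rewrite /ncone oner_eq0.
Qed.

HB.instance Definition _ := GRing.Zmodule_isNzRing.Build (ncseries k S)
  ncmulA ncmul1l ncmul1r ncmulDl ncmulDr ncone_neq0.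

Lemma ncscaleA a b f : ncscale a (ncscale b f) = ncscale (a * b) f.
Proof. by apply/funext=> w; exact: mulrA. Qed.

Lemma ncscale1 : left_id 1 ncscale.
Proof. by move=> f; apply/funext=> w; exact: mul1r. Qed.

Lemma ncscaleDr : right_distributive ncscale +%R.
Proof. by move=> a f g; apply/funext=> w; exact: mulrDr. Qed.

Lemma ncscaleDl f : {morph ncscale^~ f : a b / a + b}.
Proof. by move=> a b; apply/funext=> w; exact: mulrDl. Qed.

HB.instance Definition _ := GRing.Zmodule_isLmodule.Build k (ncseries k S)
  ncscaleA ncscale1 ncscaleDr ncscaleDl.
HB.instance Definition _ := GRing.Lmodule_isLalgebra.Build k (ncseries k S)
  ncscaleAl.
HB.instance Definition _ := GRing.Lalgebra_isAlgebra.Build k (ncseries k S)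
  ncscaleAr.

Lemma ncseries_sumE (I : Type) (r : seq I) (P : pred I) (F : I -> ncseries k S) w :
  (\sum_(i <- r | P i) F i) w = \sum_(i <- r | P i) F i w.
Proof. by elim/big_rec2: _ => // i y f _ <-. Qed.

Definition homogeneous (n : nat) f : Prop :=
  forall w, size w != n -> f w = 0.

Definition hcomp (n : nat) f : ncseries k S :=
  fun w => if size w == n then f w else 0.

Lemma hcomp_homogeneous n f : homogeneous n (hcomp n f).
Proof. by move=> w; rewrite /hcomp => /negbTE ->. Qed.

Lemma hcomp_sum f w (n : nat) :
  (size w < n)%N -> f w = (\sum_(j < n) hcomp j f) w.
Proof.
move=> wn; rewrite ncseries_sumE (bigD1 (Ordinal wn)) //= /hcomp eqxx.
rewrite big1 ?addr0 // => i ni; rewrite ifN //.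
by apply: contraNneq ni => wi; apply/eqP/val_inj.
Qed.

(* Meaningful when g has no constant term: then g ^+ j vanishes on the words
   of length < j, so that cutting off the exponential series at j = size w
   does not change the coefficient of w (see ncexpE). *)
Definition ncexp g : ncseries k S :=
  fun w => \sum_(j < (size w).+1) (j`!%:R)^-1 * (g ^+ j) w.

Lemma ncexpr_small g j w :
  hcomp 0 g = 0 -> (size w < j)%N -> (g ^+ j) w = 0.
Proof.
move=> /(congr1 (@^~ [::])); rewrite /hcomp /= => g0.
elim: j w => // j IHj w wj; rewrite exprS.
rewrite [LHS]/(ncmul g (g ^+ j) w) /ncmul big_ord_recl take0 g0 mul0r add0r.
apply: big1 => -[i ilt] _; rewrite IHj ?mulr0 // size_drop /= /bump /=.
case: w wj ilt => // x w wj _; rewrite /= add1n subSS.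
by move: wj; rewrite /= ltnS; exact: leq_ltn_trans (leq_subr _ _).
Qed.

Lemma ncexpE g w (n : nat) : hcomp 0 g = 0 -> (size w < n)%N ->
  ncexp g w = (\sum_(j < n) (j`!%:R)^-1 *: g ^+ j) w.
Proof.
move=> g0 wn; rewrite ncseries_sumE /ncexp.
rewrite (big_ord_widen n (fun j => (j`!%:R)^-1 * (g ^+ j) w) wn).
rewrite big_mkcond; apply: eq_bigr => i _; case: ifPn => // wi.
have -> : (i`!%:R^-1 *: g ^+ i) w = i`!%:R^-1 * (g ^+ i) w by [].
by rewrite ncexpr_small ?mulr0 // ltnNge -ltnS.
Qed.

End NCSeries.

(* Power series over R in one variable t commuting with the coefficients. *)
Definition tseries (R : nzRingType) : Type := nat -> R.

HB.instance Definition _ (R : nzRingType) := gen_eqMixin (tseries R).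
HB.instance Definition _ (R : nzRingType) := gen_choiceMixin (tseries R).

Section TSeries.
Variable R : nzRingType.
Implicit Types (f g h : tseries R) (r : R).

Definition tzero : tseries R := fun=> 0.
Definition topp f : tseries R := fun n => - f n.
Definition tadd f g : tseries R := fun n => f n + g n.
Definition tconst r : tseries R := fun n => if n is 0 then r else 0.
Definition tmul f g : tseries R :=
  fun n => \sum_(i < n.+1) f i * g (n - i)%N.

Lemma taddA : associative tadd.
Proof. by move=> f g h; apply/funext=> n; exact: addrA. Qed.

Lemma taddC : commutative tadd.
Proof. by move=> f g; apply/funext=> n; exact: addrC. Qed.

Lemma tadd0 : left_id tzero tadd.
Proof. by move=> f; apply/funext=> n; exact: add0r. Qed.

Lemma taddN : left_inverse tzero topp tadd.
Proof. by move=> f; apply/funext=> n; exact: addNr. Qed.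

HB.instance Definition _ :=
  GRing.isZmodule.Build (tseries R) taddA taddC tadd0 taddN.

Lemma tmul0E f g : tmul f g 0 = f 0 * g 0.
Proof. by rewrite /tmul big_ord_recl big_ord0 addr0. Qed.

Lemma tmulSE f g n :
  tmul f g n.+1 = f 0 * g n.+1 + tmul (fun i => f i.+1) g n.
Proof. by rewrite /tmul big_ord_recl. Qed.

Lemma tmulDl : left_distributive tmul +%R.
Proof.
move=> f g h; apply/funext=> n; rewrite [RHS]/GRing.add /= /tadd /tmul.
by rewrite -big_split; apply: eq_bigr => i _; exact: mulrDl.
Qed.

Lemma tmulDr : right_distributive tmul +%R.
Proof.
move=> f g h; apply/funext=> n; rewrite [RHS]/GRing.add /= /tadd /tmul.
by rewrite -big_split; apply: eq_bigr => i _; exact: mulrDr.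
Qed.

Lemma tmulA : associative tmul.
Proof.
move=> f g h; apply/funext=> n; elim: n f => [|n IHn] f.
  by rewrite !tmul0E mulrA.
have -> : tmul (tmul f g) h n.+1 =
    f 0 * g 0 * h n.+1 +
    tmul (tadd (fun i => f 0 * g i.+1) (tmul (fun i => f i.+1) g)) h n.
  rewrite tmulSE tmul0E; congr (_ + tmul _ _ _).
  by apply/funext=> i; rewrite tmulSE.
rewrite [X in _ + X](congr1 (@^~ n) (tmulDl _ _ _)) [X in _ + X]/GRing.add /=.
rewrite /tadd -IHn tmulSE tmulSE mulrDr !mulrA addrA; congr (_ + _ + _).
by rewrite /tmul mulr_sumr; apply: eq_bigr => i _; rewrite mulrA.
Qed.

Lemma tmul1l : left_id (tconst 1) tmul.
Proof.
move=> f; apply/funext=> n; rewrite /tmul big_ord_recl subn0 mul1r.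
by rewrite big1 ?addr0 // => i _; rewrite mul0r.
Qed.

Lemma tmul1r : right_id (tconst 1) tmul.
Proof.
move=> f; apply/funext=> n; rewrite /tmul big_ord_recr /= subnn mulr1.
rewrite big1 ?add0r // => i _.
by case: (n - i)%N (subn_gt0 i n) => [|m]; rewrite ?ltn_ord ?mulr0.
Qed.

Lemma tone_neq0 : tconst 1 != 0 :> tseries R.
Proof. by apply/eqP => /(congr1 (@^~ 0)) /eqP; rewrite /= oner_eq0. Qed.

HB.instance Definition _ := GRing.Zmodule_isNzRing.Build (tseries R)
  tmulA tmul1l tmul1r tmulDl tmulDr tone_neq0.

Definition tderiv f : tseries R := fun j => f j.+1 *+ j.+1.

Definition tbigO (q : nat) f : Prop := forall j, (j < q)%N -> f j = 0.

End TSeries.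

Definition phi (k : fieldType) (S : Type) (f : ncseries k S) :
  tseries (ncseries k S) := fun j => hcomp j f.

(* Main.v *)
(* Two series without constant term which agree below degree n have powers of
   exponent at least 2 agreeing below degree n + 1, so that ncexp Z - Z is
   determined below degree n + 1 by Z below degree n.  By induction on n, two
   such series agree below degree n iff their exponentials do; as the degree j
   component of ncexp C is C ^ j / j!, this is the equivalence of (A) and (C).
   The degree j coefficient of (B) reads (j + 1) h_(j+1) = C h_j, which
   determines the h_j recursively from h_0 = 1. *)
Require Import Defs.
From mathcomp Require Import all_boot all_order all_algebra.
From mathcomp Require Import boolp.

Set Implicit Arguments.
Unset Strict Implicit.
Unset Printing Implicit Defensive.

Import GRing.Theory.
Local Open Scope ring_scope.

Section TruncatedEquality.
Variables (k : fieldType) (S : Type).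
Implicit Types (f g C Z : ncseries k S) (w : seq S).

Lemma ncmulE f g w :
  (f * g) w = \sum_(i < (size w).+1) f (take i w) * g (drop i w).
Proof. by []. Qed.

Lemma ncsubE f g w : (f - g) w = f w - g w.
Proof. by []. Qed.

Lemma hcomp0_nil f : hcomp 0 f = 0 -> f [::] = 0.
Proof. by move/(congr1 (@^~ [::])). Qed.

(** Congruence modulo the two-sided ideal of series supported in degrees at least [n], hence
    compatible with products and powers. *)
Definition eq_below n f g := forall w, (size w < n)%N -> f w = g w.

Lemma hcomp_eq_below p f g :
  (forall j, (j <= p)%N -> hcomp j f = hcomp j g) <-> eq_below p.+1 f g.
Proof.
split=> [fg w wp | fg j jp].
  by have /(congr1 (@^~ w)) := fg (size w) wp; rewrite /hcomp eqxx.
by apply/funext=> w; rewrite /hcomp; case: eqP => // wj; apply: fg; rewrite wj.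
Qed.

Lemma hcomp_sub_eq_below p f g :
  (forall j, (j <= p)%N -> hcomp j (f - g) = 0) <-> eq_below p.+1 f g.
Proof.
split=> [fg w wp | fg j jp].
  have /(congr1 (@^~ w)) := fg (size w) wp.
  by rewrite /hcomp eqxx ncsubE => /subr0_eq.
apply/funext=> w; rewrite /hcomp; case: eqP => // wj.
by rewrite ncsubE fg ?subrr // wj.
Qed.

Lemma eq_below_mul n f f' g g' :
  eq_below n f f' -> eq_below n g g' -> eq_below n (f * g) (f' * g').
Proof.
move=> ff' gg' w wn; rewrite !ncmulE; apply: eq_bigr => i _.
rewrite ff' ?gg' //.
  by rewrite size_drop; apply: leq_ltn_trans (leq_subr _ _) wn.
by apply: leq_ltn_trans wn; rewrite size_take_min geq_minr.
Qed.

Lemma eq_below_exp n f g j : eq_below n f g -> eq_below n (f ^+ j) (g ^+ j).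
Proof.
by move=> fg; elim: j => // j IHj; rewrite !exprS; apply: eq_below_mul.
Qed.

(** The two extreme factorizations of a word contribute nothing for lack of constant terms; in any
    other, both factors are strictly shorter than the word, which gains one degree. *)
Lemma eq_below_mulS n f f' g g' :
  f [::] = 0 -> f' [::] = 0 -> g [::] = 0 -> g' [::] = 0 ->
  eq_below n f f' -> eq_below n g g' -> eq_below n.+1 (f * g) (f' * g').
Proof.
move=> f0 f'0 g0 g'0 ff' gg' w wn; rewrite !ncmulE; apply: eq_bigr => i _.
have [i0|i_gt0] := posnP i; first by rewrite i0 take0 f0 f'0 !mul0r.
have := ltn_ord i; rewrite ltnS leq_eqVlt => /orP[/eqP->|iw].
  by rewrite drop_size g0 g'0 !mulr0.
rewrite ff' ?gg' // ?size_drop ?size_take ?iw.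
  rewrite ltnS in wn; apply: leq_trans wn.
  by rewrite ltn_subrL i_gt0 (leq_ltn_trans _ iw).
exact: leq_trans iw wn.
Qed.

Lemma eq_below_ncexp_sub n f g : hcomp 0 f = 0 -> hcomp 0 g = 0 ->
  eq_below n f g -> eq_below n.+1 (ncexp f - f) (ncexp g - g).
Proof.
move=> f0 g0 fg w wn; have [f00 g00] := (hcomp0_nil f0, hcomp0_nil g0).
(* One term more than necessary, so that exponents 0 and 1 can be split off even when [w] is
   empty. *)
have ws : (size w < (size w).+2)%N by [].
rewrite !ncsubE (ncexpE f0 ws) (ncexpE g0 ws) !ncseries_sumE !big_ord_recl /=.
have E a (u : ncseries k S) : (a *: u) w = a * u w by [].
rewrite !E !expr0 !expr1 invr1 !mul1r.
have cancel (a b c : k) : a + (b + c) - b = a + c by rewrite addrA addrAC addrK.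
rewrite !cancel; congr (_ + _).
apply: eq_bigr => i _; rewrite !E /bump /= !add1n; congr (_ * _).
(* The remaining exponents are [i.+2], so both [f] and the cofactor [f ^+ i.+1] lack a constant
   term. *)
rewrite exprS [in RHS]exprS; apply: (eq_below_mulS (n := n)) => //.
- exact: ncexpr_small.
- exact: ncexpr_small.
- exact: eq_below_exp.
Qed.

Lemma eq_below_ncexp n f g : hcomp 0 f = 0 -> hcomp 0 g = 0 ->
  eq_below n f g <-> eq_below n (ncexp f) (ncexp g).
Proof.
move=> f0 g0; elim: n => [|n IHn]; first by split=> _ w.
have le_n u v : eq_below n.+1 u v -> eq_below n u v.
  by move=> uv w wn; apply: uv; apply: ltnW.
split=> fg w wn.
  have /(eq_below_ncexp_sub f0 g0) /(_ w wn) := le_n _ _ fg.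
  by rewrite !ncsubE fg // => /addIr.
(* Here the induction hypothesis first recovers agreement of [f] and [g] below [n]. *)
have /IHn /(eq_below_ncexp_sub f0 g0) /(_ w wn) := le_n _ _ fg.
by rewrite !ncsubE fg // => /addrI/oppr_inj.
Qed.

Lemma homogeneous_mul m n f g :
  homogeneous m f -> homogeneous n g -> homogeneous (m + n) (f * g).
Proof.
move=> fm gn w wmn; rewrite ncmulE; apply: big1 => i _.
have [ti|/fm->] := eqVneq (size (take i w)) m; last by rewrite mul0r.
rewrite gn ?mulr0 //; apply: contraNneq wmn => di.
by rewrite -ti -di -size_cat cat_take_drop.
Qed.

Lemma homogeneous_exp C j : homogeneous 1 C -> homogeneous j (C ^+ j).
Proof.
move=> C1; elim: j => [|j IHj]; first by case.
by rewrite exprS -add1n; apply: homogeneous_mul.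
Qed.

(** Since [C ^+ i] lives in degree [i] alone, only the last term kept by the truncation at length
    [j] survives. *)
Lemma hcomp_ncexp_homogeneous C j :
  homogeneous 1 C -> hcomp j (ncexp C) = (j`!%:R)^-1 *: C ^+ j.
Proof.
move=> C1; apply/funext=> w.
have -> : ((j`!%:R)^-1 *: C ^+ j) w = (j`!%:R)^-1 * (C ^+ j) w by [].
rewrite /hcomp; case: eqVneq => [wj|wj]; last by rewrite homogeneous_exp ?mulr0.
rewrite /ncexp wj big_ord_recr /= big1 ?add0r // => i _.
by rewrite homogeneous_exp ?mulr0 // wj gtn_eqF.
Qed.

Lemma hcomp0_ncexp Z : hcomp 0 (ncexp Z) = 1.
Proof.
apply/funext=> -[|x w] //.
by rewrite /hcomp /= /ncexp big_ord_recl big_ord0 addr0 /= invr1 mul1r.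
Qed.

End TruncatedEquality.

Lemma tconst_mulE (R : nzRingType) (r : R) (f : tseries R) j :
  (tconst r * f) j = r * f j.
Proof.
rewrite [LHS]/(tmul _ _ _) /tmul big_ord_recl subn0 big1 ?addr0 // => i _.
by rewrite mul0r.
Qed.

(** In characteristic zero [j.+1] can be cancelled, so the recursion starting at 1 has the divided
    powers of [C] as its only solution. *)
Lemma exp_recurrence (k : fieldType) (A : algType k) (C : A) (u : nat -> A) p :
  [pchar k] =i pred0 -> u 0 = 1 ->
  (forall j, (j <= p)%N -> u j = (j`!%:R)^-1 *: C ^+ j) <->
  (forall j, (j < p)%N -> u j.+1 *+ j.+1 = C * u j).
Proof.
move=> k0 u0; have nz n : (n.+1)%:R != 0 :> k by have [+ _] := pcharf0P k => ->.
have factV n : (n.+1)%:R * ((n.+1)`!%:R)^-1 = (n`!%:R)^-1 :> k.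
  by rewrite factS natrM invfM mulrA divff ?mul1r.
split=> uC j; first move=> jp.
  rewrite !uC //; last exact: ltnW.
  by rewrite -scaler_nat scalerA factV exprS scalerAr.
elim: j => [|j IHj] jp; first by rewrite u0 expr0 invr1 scale1r.
apply: (scalerI (nz j)).
by rewrite scaler_nat uC // IHj ?(ltnW jp) // scalerA factV exprS scalerAr.
Qed.

Theorem proposition3p4 (k : fieldType) (S : Type) (p : nat)
    (h Z C : ncseries k S) :
  [pchar k] =i pred0 ->
  (1 <= p)%N ->
  hcomp 0 Z = 0 ->
  h = ncexp Z ->
  homogeneous 1 C ->
  [<-> (* A *) forall j : nat, (j <= p)%N ->
                 hcomp j h - (j`!%:R)^-1 *: C ^+ j = 0;
       (* B *) tbigO p (tderiv (phi h) - tconst C * phi h);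
       (* C *) forall j : nat, (j <= p)%N -> hcomp j (Z - C) = 0;
       (* C *) tbigO p.+1 (phi (Z - C))].
Proof.
move=> k0 _ Z0 -> C1.
have C0 : hcomp 0 C = 0.
  by apply/funext=> w; rewrite /hcomp; case: eqP => // w0; rewrite C1 ?w0.
have AC : (forall j, (j <= p)%N ->
             hcomp j (ncexp Z) = (j`!%:R)^-1 *: C ^+ j) <-> eq_below p.+1 Z C.
  rewrite (eq_below_ncexp p.+1 Z0 C0) -hcomp_eq_below.
  by split=> + j jp => /(_ j jp) ->; rewrite hcomp_ncexp_homogeneous.
have AB := @exp_recurrence k _ C (phi (ncexp Z)) p k0 (hcomp0_ncexp Z).
tfae.
- move=> A j jp; apply/eqP; rewrite subr_eq0; apply/eqP.
  by rewrite tconst_mulE; apply: AB.1 jp => i /A /subr0_eq.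
- move=> B; apply/hcomp_sub_eq_below/AC/AB => j /B /subr0_eq.
  by rewrite tconst_mulE.
(* The coefficients of [phi (Z - C)] are by definition the components of [Z - C]. *)
- by [].
- by move=> /hcomp_sub_eq_below /AC A j jp; rewrite A ?subrr.
Qed.
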